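(* Let $A \in \mathcal M_d(\mathbb R)$ satisfy $\rho(A) < 1$, let $\tau$ be a bounded delay function such that $\inf_{s \in [0, t]} \tau(s) > 0$ for every $t \geq 0$, and let $h$ be its associated largest delay function. Then there exist positive constants $C$ and $\gamma$ such that, for every continuous solution $x \in C(\lvert -h(0), +\infty), \mathbb R^d)$ of $$x(t) = A x(t - \tau(t)), \qquad t \geq 0,$$ with a bounded initial condition $x_0 \in \mathsf C_0^{\mathrm b}$, we have $$\lVert x_t\rVert_{\mathsf C_t^{\mathrm b}} \leq C e^{-\gamma t} \lVert x_0\rVert_{\mathsf C_0^{\mathrm b}} \qquad \text{for every } t \in \mathbb R_+.$$
   Context: $\mathbb R_+ = [0, +\infty)$, $\mathbb R_+^\ast = (0, +\infty)$; $\mathcal M_d(\mathbb R)$ is the set of real $d \times d$ matrices, $d$ a positive integer, $\rho(A)$ is the spectral radius of $A$, and $\lvert\cdot\rvert$ is a norm on $\mathbb R^d$. For $a \leq b$ in $\mathbb R \cup \{\pm\infty\}$, the interval $\lvert a, b]$ denotes $[a, b]$ if $a > -\infty$ and $(a, b]$ if $a = -\infty$; $\lvert a, b)$ is defined similarly. A \emph{delay function} is any function $\tau\colon \mathbb R_+ \to \mathbb R_+^\ast$. Its \emph{largest delay function} is $h\colon \mathbb R_+ \to \mathbb R_+^\ast \cup \{+\infty\}$, $h(t) = t - \inf_{s \in [t, +\infty)} (s - \tau(s))$. A \emph{continuous solution} is a continuous function $x\colon \lvert -h(0), +\infty) \to \mathbb R^d$ such that $x(t) = A x(t - \tau(t))$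 for every $t \in \mathbb R_+$; its \emph{initial condition} is its restriction to $\lvert -h(0), 0]$. For $t \in \mathbb R_+$, $\mathsf C_t^{\mathrm b}$ is the set of bounded functions $y \in C(\lvert -h(t), 0], \mathbb R^d)$ with $y(0) = A y(-\tau(t))$, with norm $\lVert y\rVert_{\mathsf C_t^{\mathrm b}} = \sup_{s \in \lvert -h(t), 0]} \lvert y(s)\rvert$, and $x_t\colon \lvert -h(t), 0] \to \mathbb R^d$ is defined by $x_t(s) = x(t + s)$. *)

(* Defs.v *)
From HB Require Import structures.
From mathcomp Require Import all_boot all_order all_algebra.
From mathcomp Require Import complex.
From mathcomp Require Import all_classical all_reals all_analysis.

Set Implicit Arguments.
Unset Strict Implicit.
Unset Printing Implicit Defensive.

Import Order.TTheory GRing.Theory Num.Theory.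
Import numFieldNormedType.Exports.

Local Open Scope classical_set_scope.
Local Open Scope ring_scope.

(* An arbitrary norm, in general different from the max norm that 'cV[R]_d
   carries in the library; the topology of 'cV[R]_d does not depend on this
   choice. *)
Record is_norm (R : realType) (d : nat) (N : 'cV[R]_d -> R) : Prop := IsNorm {
  is_norm_triangle : forall v w, N (v + w) <= N v + N w;
  is_norm_scale : forall (a : R) v, N (a *: v) = `|a| * N v;
  is_norm_definite : forall v, N v = 0 -> v = 0 }.

(* The set of moduli is finite, and nonempty as soon as 0 < d. *)
Definition spectral_radius (R : realType) (d : nat) (A : 'M[R]_d) : R :=
  sup [set Normc.normc z |
        z in [set z : R[i] | eigenvalue (map_mx (real_complex R) A) z]].

(* Functions on R_+ are total functions on R whose values at negative reals
   are irrelevant. *)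
Definition delay_function (R : realType) (tau : R -> R) : Prop :=
  forall t, 0 <= t -> 0 < tau t.

Definition largest_delay (R : realType) (tau : R -> R) (t : R) : \bar R :=
  (t%:E - ereal_inf [set (s - tau s)%:E | s in [set s : R | (t <= s)%R]])%E.

(* |a, b] and |a, b) as sets of reals: a is included if and only if a is
   finite, since only real s are considered. *)
Definition bar_cc (R : realType) (a b : \bar R) : set R :=
  [set s : R | (a <= s%:E)%E /\ (s%:E <= b)%E].

Definition bar_co (R : realType) (a b : \bar R) : set R :=
  [set s : R | (a <= s%:E)%E /\ (s%:E < b)%E].

(* The relevant domain of a history function at time t: |- h(t), 0]. *)
Definition hist_dom (R : realType) (tau : R -> R) (t : R) : set R :=
  bar_cc (- largest_delay tau t)%E 0%E.

(* x : R -> R^d stands for its restriction to |- h(0), +oo). *)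
Definition continuous_solution (R : realType) (d : nat) (A : 'M[R]_d)
    (tau : R -> R) (x : R -> 'cV[R]_d) : Prop :=
  {within bar_co (- largest_delay tau 0)%E +oo%E, continuous x} /\
  (forall t, 0 <= t -> x t = A *m x (t - tau t)).

Definition history (R : realType) (d : nat) (x : R -> 'cV[R]_d) (t : R)
    : R -> 'cV[R]_d :=
  fun s => x (t + s).

Definition Cb (R : realType) (d : nat) (N : 'cV[R]_d -> R) (A : 'M[R]_d)
    (tau : R -> R) (t : R) (y : R -> 'cV[R]_d) : Prop :=
  [/\ {within hist_dom tau t, continuous y},
      (exists M : R, forall s, hist_dom tau t s -> N (y s) <= M) &
      y 0 = A *m y (- tau t)].

(* Extended-real valued: an unbounded y has norm +oo, whereas the real-valued
   sup would be 0. *)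
Definition Cb_norm (R : realType) (d : nat) (N : 'cV[R]_d -> R)
    (tau : R -> R) (t : R) (y : R -> 'cV[R]_d) : \bar R :=
  ereal_sup [set (N (y s))%:E | s in hist_dom tau t].

(* Main.v *)
(** Iterating the equation backwards gives x(u) = A^n x(w) with w in the initial
    interval; since tau <= K, at least u / K steps are needed, so the decay of
    A^n becomes exponential decay in time. The decay |A^n| <= D r^n for some
    r < 1 is obtained over the complex numbers without any normal form: by
    Cayley-Hamilton the product of the A - z I over the eigenvalues z vanishes,
    and the factors are removed one at a time, because a sequence u with
    u_(n+1) - z u_n = O(r^n) and |z| < r is itself O(r^n). *)

Require Import Defs.
From HB Require Import structures.
From mathcomp Require Import all_boot all_order all_algebra.
From mathcomp Require Import complex.
From mathcomp Require Import lra.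
From mathcomp Require Import all_classical all_reals all_analysis.

Set Implicit Arguments.
Unset Strict Implicit.
Unset Printing Implicit Defensive.

Import Order.TTheory GRing.Theory Num.Theory.
Import numFieldNormedType.Exports.

Local Open Scope classical_set_scope.
Local Open Scope ring_scope.

(** * Geometric decay of matrix powers *)

Lemma recurrence_bound (K : numFieldType) (V : normedModType K) (z : K)
    (r C : K) (u : nat -> V) :
  `|z| < r -> 0 <= C ->
  (forall n, `|u n.+1 - z *: u n| <= C * r ^+ n) ->
  exists2 D, 0 <= D & forall n, `|u n| <= D * r ^+ n.
Proof.
move=> zr C0 uC; have r0 : 0 < r by exact: le_lt_trans zr.
have rz : 0 < r - `|z| by rewrite subr_gt0.
(* The first term of [D] starts the induction; the second gives C + |z| D <= r D, which is the
   inductive step. *)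
pose D := `|u 0%N| + C / (r - `|z|).
have D0 : 0 <= D by rewrite addr_ge0// divr_ge0// ltW.
exists D => //; elim=> [|n IHn].
  by rewrite expr0 mulr1 lerDl divr_ge0// ltW.
rewrite -(subrK (z *: u n) (u n.+1)) (le_trans (ler_normD _ _))//.
rewrite (le_trans (lerD (uC n) (lexx _)))// normrZ.
rewrite (le_trans (lerD (lexx _) (ler_wpM2l _ IHn)))//.
rewrite exprS !mulrA -mulrDl ler_wpM2r ?exprn_ge0 ?(ltW r0)//.
rewrite [D * r]mulrC -lerBrDr -mulrBl /D mulrDr mulrCA divff ?gt_eqF// mulr1.
by rewrite lerDr mulr_ge0// ltW.
Qed.

(** [Q] is arbitrary so that the last factor can be absorbed into it: the induction hypothesis for
    [(A - z%:M) * Q] bounds u_(n+1) - z u_n, where u_n = [A ^+ n * Q]. *)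
Lemma expmx_annihilated_bound (K : numFieldType) d (A Q : 'M[K]_d.+1) (r : K)
    (s : seq K) :
  (forall z, z \in s -> `|z| < r) -> 0 < r ->
  \prod_(z <- s) (A - z%:M) * Q = 0 ->
  exists2 D : K, 0 <= D & forall n, `|A ^+ n * Q| <= D * r ^+ n.
Proof.
elim/last_ind: s Q => [|s z IHs] Q sr r0.
  by rewrite big_nil mul1r => ->; exists 0 => // n; rewrite mulr0 normr0 mul0r.
rewrite big_rcons -mulrA => /IHs[|//|C C0 CP].
  by move=> y ys; apply: sr; rewrite mem_rcons inE ys orbT.
apply: (@recurrence_bound _ _ z r C) => // [|n].
  by apply: sr; rewrite mem_rcons mem_head.
rewrite (le_trans _ (CP n))// le_eqVlt; apply/orP; left; apply/eqP.
congr (`|_|).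
by rewrite mulrBl mulrBr mulrA -exprSr -!mulmxE mul_scalar_mx -scalemxAr.
Qed.

Lemma expmx_bound (R : realType) d (A : 'M[R]_d.+1) :
  spectral_radius A < 1 ->
  exists r D : R, [/\ 0 < r, r < 1, 0 <= D &
    forall n i j, `|(A ^+ n) i j| <= D * r ^+ n].
Proof.
rewrite /spectral_radius; set B := map_mx _ A; set S := [set _ | _ in _] => S1.
have [s Bs] := closed_field_poly_normal (char_poly B).
move: Bs; rewrite (monicP (char_poly_monic B)) scale1r => Bs.
have eigenE z : eigenvalue B z = (z \in s).
  by rewrite eigenvalue_root_char Bs root_prod_XsubC.
(* Any [r] strictly between the spectral radius and 1 would do; the maximum with 0 yields r > 0
   without discussing the sign of the supremum. *)
pose r := (1 + Num.max 0 (sup S)) / 2.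
have m1 : Num.max 0 (sup S) < 1 by rewrite gt_max ltr01.
have m0 : 0 <= Num.max 0 (sup S) by rewrite le_max lexx.
have r1 : r < 1 by rewrite /r; lra.
have r0 : 0 < r by rewrite /r; lra.
have mr : Num.max 0 (sup S) < r by rewrite /r; lra.
have sr z : z \in s -> `|z| < r%:C%C.
  move=> zs; have Sz : S (Normc.normc z) by exists z => //=; rewrite eigenE.
  have -> : `|z| = (Normc.normc z)%:C%C by case: (z) => a b; rewrite normc_def.
  rewrite ltcR (le_lt_trans _ mr)// le_max; apply/orP; right.
  (* [S] must be bounded above for [sup S] to dominate it: the sum of the moduli of all roots is an
     upper bound. *)
  apply: ub_le_sup => //; exists (\sum_(y <- s) Normc.normc y).
  move=> _ [y /= + <-]; rewrite eigenE => ys.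
  rewrite (big_rem y)//= lerDl sumr_ge0// => -[a b] _; exact: sqrtr_ge0.
have r0C : 0 < r%:C%C by rewrite ltcR.
case: (@expmx_annihilated_bound _ _ B 1 _ s sr r0C).
  rewrite mulr1 -[RHS](Cayley_Hamilton B) Bs rmorph_prod; apply: eq_bigr => z _.
  by rewrite rmorphB/= horner_mx_X horner_mx_C.
(* A nonnegative complex number is real, so the bound descends to [R]. *)
move=> D D0 DB; have [D' DD'] : exists D' : R, D = D'%:C%C.
  by case: D D0 {DB} => a b; rewrite lecE => /= /andP[/eqP->]; exists a.
move: D0; rewrite DD' lecR => D0.
exists r, D'; split => // n i j.
rewrite -lecR; have -> : (D' * r ^+ n)%:C%C = D * r%:C%C ^+ n.
  by rewrite DD' rmorphM rmorphXn.
apply: le_trans (DB n); rewrite mulr1 /B -rmorphXn/=.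
have -> : (`|(A ^+ n) i j|)%:C%C = `|map_mx (real_complex R) (A ^+ n) i j|.
  by rewrite mxE normc_def/= expr0n addr0 sqrtr_sqr.
by rewrite [leRHS]/Num.norm/= mx_normE -[leLHS]nngE num_le (le_bigmax _ _ (i, j)).
Qed.

(** * Comparison of an arbitrary norm with the coordinates *)

Section norm_equivalence.
Variables (R : realType) (d : nat) (N : 'cV[R]_d -> R) (N_norm : is_norm N).

Let N_triangle := is_norm_triangle N_norm.
Let N_scale := is_norm_scale N_norm.

Lemma is_norm0 : N 0 = 0.
Proof. by rewrite -(scale0r (0 : 'cV[R]_d)) N_scale normr0 mul0r. Qed.

Lemma is_normN v : N (- v) = N v.
Proof. by rewrite -scaleN1r N_scale normrN1 mul1r. Qed.

Lemma is_norm_ge0 v : 0 <= N v.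
Proof. by have := N_triangle v (- v); rewrite subrr is_norm0 is_normN; lra. Qed.

Lemma is_norm_sum (I : finType) (F : I -> 'cV[R]_d) :
  N (\sum_i F i) <= \sum_i N (F i).
Proof.
elim/big_ind2 : _ => [|x y u v xy uv|//]; first by rewrite is_norm0.
exact: le_trans (N_triangle _ _) (lerD xy uv).
Qed.

Lemma is_norm_le_coord :
  exists2 M : R, 0 <= M &
    forall (v : 'cV[R]_d) c, (forall i, `|v i 0| <= c) -> N v <= M * c.
Proof.
exists (\sum_(i < d) N (delta_mx i 0)).
  by apply: sumr_ge0 => i _; exact: is_norm_ge0.
move=> v c vc; rewrite {1}(matrix_sum_delta v) (le_trans (is_norm_sum _))//.
rewrite mulr_suml; apply: ler_sum => i _.
by rewrite big_ord1 N_scale mulrC ler_wpM2l// is_norm_ge0.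
Qed.

(** By the previous lemma [N] is Lipschitz for the max norm, so it attains a minimum on the compact
    unit sphere. The minimum is positive by definiteness, and its inverse is the constant. The
    argument runs on row vectors, to which [bounded_closed_compact] applies. *)
Lemma coord_le_is_norm :
  exists2 m : R, 0 <= m & forall (v : 'cV[R]_d) i, `|v i 0| <= m * N v.
Proof.
have [M M0 NM] := is_norm_le_coord.
pose f (v : 'rV[R]_d) := N v^T.
have coordr (v : 'rV[R]_d) i : `|v 0 i| <= `|v|.
  by rewrite [leRHS]/Num.norm/= mx_normE -[leLHS]nngE num_le (le_bigmax _ _ (0, i)).
have fM (v : 'rV[R]_d) : f v <= M * `|v| by apply: NM => i; rewrite mxE.
have f_sub v w : f v - f w <= M * `|v - w|.
  rewrite lerBlDr (le_trans _ (lerD (fM _) (lexx _)))//.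
  by rewrite /f linearB/= (le_trans _ (N_triangle _ _))// subrK.
have f_lip v w : `|f v - f w| <= M * `|v - w|.
  by rewrite ler_norml f_sub andbT lerNl opprB distrC f_sub.
have f_cont : continuous f.
  move=> v; apply/(@cvgrPdist_lt _ _ _ _ (nbhs_filter v)) => e e0.
  have M1 : 0 < M + 1 by rewrite ltr_wpDl.
  apply/(@nbhs_ballP _ _ (v : 'rV[R]_d)).
  exists (e / (M + 1)) => [|w]; first by rewrite /= divr_gt0.
  rewrite -ball_normE/=.
  rewrite ltr_pdivlMr// mulrC; apply: le_lt_trans.
  by rewrite (le_trans (f_lip _ _))// ler_wpM2r// lerDl.
pose S := [set v : 'rV[R]_d | `|v| = 1].
(* If the sphere is empty, as for d = 0, normalizing shows that every vector vanishes. *)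
have [Sn0|S0] := pselect (S !=set0); last first.
  exists 0 => // v i; rewrite mul0r; have [v0|v0] := eqVneq v^T 0.
    by rewrite -(trmxK v) v0 !mxE normr0.
  by exfalso; apply: S0; exists (`|v^T|^-1 *: v^T); rewrite /S/= normfZV.
have cS : compact S.
  apply: bounded_closed_compact.
    by exists 1; split => // x x1 v; rewrite /S/= => ->; exact: ltW.
  rewrite (_ : S = Num.norm @^-1` [set 1])//.
  by apply: closed_comp => [? _|]; [exact: norm_continuous|exact: closed_eq].
have [c cS1 fc] := compact_EVT_min Sn0 cS (continuous_subspaceT f_cont).
have fc0 : 0 < f c.
  rewrite lt_neqAle is_norm_ge0 andbT eq_sym; apply/eqP => /(is_norm_definite N_norm).
  move=> /(congr1 trmx); rewrite trmxK trmx0 => c0.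
  by move: cS1; rewrite inE /S/= c0 normr0 => /esym/eqP; rewrite oner_eq0.
exists (f c)^-1 => [|v i]; first by rewrite invr_ge0 ltW.
rewrite mulrC ler_pdivlMr//.
have [v0|v0] := eqVneq v^T 0.
  have -> : v = 0 by rewrite -(trmxK v) v0 trmx0.
  by rewrite mxE normr0 mul0r is_norm_ge0.
have vS : `|v^T|^-1 *: v^T \in S by rewrite inE /S/= normfZV.
have := fc _ vS; rewrite /f linearZ/= trmxK N_scale normfV normr_id.
rewrite mulrC ler_pdivlMr ?normr_gt0// mulrC; apply: le_trans.
by rewrite ler_wpM2r ?is_norm_ge0// (le_trans _ (coordr _ i))// mxE.
Qed.

End norm_equivalence.

Lemma is_norm_expmx_bound (R : realType) d (N : 'cV[R]_d.+1 -> R)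
    (A : 'M[R]_d.+1) :
  is_norm N -> spectral_radius A < 1 ->
  exists r C : R, [/\ 0 < r, r < 1, 0 < C &
    forall n v, N (A ^+ n *m v) <= C * r ^+ n * N v].
Proof.
move=> N_norm /expmx_bound[r [D [r0 r1 D0 DA]]].
have [M M0 NM] := is_norm_le_coord N_norm.
have [m m0 mN] := coord_le_is_norm N_norm.
(* [M] and [m] convert between [N] and coordinates, [d.+1] counts the terms of each entry of the
   product, and the added 1 makes the constant positive. *)
exists r, (M * d.+1%:R * D * m + 1); split => //.
  by rewrite ltr_wpDl// !mulr_ge0.
move=> n v; have rn0 : 0 <= r ^+ n by rewrite exprn_ge0// ltW.
have Nv0 := is_norm_ge0 N_norm v.
apply: (@le_trans _ _ (M * (d.+1%:R * (D * r ^+ n * (m * N v))))).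
  apply: NM => i; rewrite mxE (le_trans (ler_norm_sum _ _ _))//.
  rewrite mulr_natl -[X in _ *+ X]card_ord -sumr_const; apply: ler_sum => j _.
  by rewrite normrM ler_pM.
have := mulr_ge0 rn0 Nv0; lra.
Qed.

(** * Backward orbits under a bounded delay *)

Section delay.
Variables (R : realType) (tau : R -> R).
Hypothesis tau_delay : delay_function tau.
Variable K : R.
Hypothesis tau_le : forall t, 0 <= t -> tau t <= K.

Definition delay_inf (t : R) : \bar R :=
  ereal_inf [set (s - tau s)%:E | s in [set s : R | (t <= s)%R]].

Lemma delay_inf_ge t : 0 <= t -> ((t - K)%:E <= delay_inf t)%E.
Proof.
move=> t0; apply: le_ereal_inf_tmp => _ [s /= ts <-].
by rewrite lee_fin lerB// tau_le// (le_trans t0).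
Qed.

Lemma delay_inf_le t s : t <= s -> (delay_inf t <= (s - tau s)%:E)%E.
Proof. by move=> ts; apply: ereal_inf_lbound; exists s. Qed.

(** The bound on [tau] makes the infimum finite, so the extended-real inequality - h(t) <= s can be
    rearranged. *)
Lemma hist_domE t s :
  0 <= t -> hist_dom tau t s <-> (delay_inf t <= (t + s)%:E)%E /\ s <= 0.
Proof.
move=> t0; have fin : delay_inf t \is a fin_num.
  apply/fin_real/andP; split.
    by rewrite (lt_le_trans _ (delay_inf_ge t0))// ltNyr.
  by rewrite (le_lt_trans (delay_inf_le (lexx t)))// ltry.
rewrite /hist_dom /bar_cc /largest_delay -/(delay_inf t)/=.
by rewrite fin_num_oppeB// addeC leeBlDl// -EFinD lee_fin.
Qed.

(* The backward orbit u, u - tau u, ... reaches the initial interval after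
   finitely many steps since tau is bounded away from 0 on [0, u]. *)
Lemma continuous_solution_unroll d (A : 'M[R]_d.+1) (x : R -> 'cV[R]_d.+1) u :
  (forall t, 0 <= t -> 0 < inf [set tau s | s in `[0, t]]) ->
  continuous_solution A tau x ->
  (delay_inf 0 <= u%:E)%E ->
  exists n w, [/\ hist_dom tau 0 w, u <= n%:R * K & x u = A ^+ n *m x w].
Proof.
move=> tau_inf [_ xA].
have base v : (delay_inf 0 <= v%:E)%E -> v <= 0 ->
    exists n w, [/\ hist_dom tau 0 w, v <= n%:R * K & x v = A ^+ n *m x w].
  move=> Iv v0; exists 0%N, v; split; rewrite ?mul0r ?expr0 ?mul1mx//.
  by apply/hist_domE; rewrite ?add0r.
have [u0|/ltW u0] := leP u 0; first by move=> /base; exact.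
set del := inf [set tau s | s in `[0, u]].
have del0 : 0 < del := tau_inf _ u0.
have le_del v : 0 <= v -> v <= u -> del <= tau v.
  move=> v0 vu; apply: ge_inf; last by exists v => //=; rewrite in_itv/= v0.
  by exists 0 => _ [s /=] /[!in_itv]/= /andP[s0 _] <-; exact/ltW/tau_delay.
(* A backward step from a point of [0, u] has length between [del] and [K]: the lower bound lets the
   induction on [k] terminate, the upper one gives v <= n K for the number [n] of steps taken. *)
suff H k v : v <= u -> v <= k%:R * del -> (delay_inf 0 <= v%:E)%E ->
    exists n w, [/\ hist_dom tau 0 w, v <= n%:R * K & x v = A ^+ n *m x w].
  apply: (H (Num.truncn (u / del)).+1) => //.
  by rewrite -ler_pdivrMr// ltW// truncnS_gt.
elim: k v => [|k IHk] v vu vk Iv.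
  by apply: base => //; rewrite mul0r in vk.
have [v0|/ltW v0] := leP v 0; first exact: base.
have := le_del _ v0 vu; have := tau_le v0; have := tau_delay v0 => tv0 tvK dtv.
have [|||n [w [w0 vn xw]]] := IHk (v - tau v).
- lra.
- by move: vk; rewrite -natr1 mulrDl; lra.
- exact: delay_inf_le.
exists n.+1, w; split => //; first by rewrite -natr1 mulrDl; lra.
by rewrite xA// xw mulmxA exprS.
Qed.

End delay.

Theorem corollary5p16 (R : realType) (d : nat) (d_gt0 : (0 < d)%N)
    (N : 'cV[R]_d -> R) (N_norm : is_norm N)
    (A : 'M[R]_d) (rhoA : spectral_radius A < 1)
    (tau : R -> R) (tau_delay : delay_function tau)
    (tau_bounded : [bounded tau t | t in [set t : R | 0 <= t]])
    (tau_inf : forall t : R, 0 <= t -> 0 < inf [set tau s | s in `[0, t]]) :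
  exists C gamma : R, [/\ 0 < C, 0 < gamma &
    forall x : R -> 'cV[R]_d,
      continuous_solution A tau x ->
      Cb N A tau 0 (history x 0) ->
      forall t : R, 0 <= t ->
        (Cb_norm N tau t (history x t) <=
           (C * expR (- gamma * t))%:E * Cb_norm N tau 0 (history x 0))%E].
Proof.
case: d d_gt0 N N_norm A rhoA => // d _ N N_norm A rhoA.
have [r [C [r0 r1 C0 NA]]] := is_norm_expmx_bound N_norm rhoA.
have [K K0 tau_le] : exists2 K, 0 < K & forall t, 0 <= t -> tau t <= K.
  have [M [_ tauM]] := tau_bounded.
  (* Boundedness provides a bound by every number above [M]; the maximum with 0 ensures K > 0. *)
  exists (Num.max M 0 + 1) => [|t t0].
    by rewrite ltr_wpDl// le_max lexx orbT.
  by rewrite (le_trans (ler_norm _))// tauM// ltr_pwDr// le_max lexx.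
pose g := - ln r.
have g0 : 0 < g by rewrite oppr_gt0 ln_lt0// r0.
have rE n : r ^+ n = expR (- g * n%:R).
  by rewrite opprK mulrC expRM_natl lnK.
(* Points of the history at time t are at least t - K, so n >= t / K - 1 steps are taken: the rate
   is g / K, and the lost unit costs the factor e^g. *)
exists (C * expR g), (g / K); split; rewrite ?divr_gt0 ?mulr_gt0 ?expR_gt0//.
move=> x xsol _ t t0; apply: ge_ereal_sup => _ [s /(hist_domE tau_le _ t0)[Is s0] <-].
have I0 : (delay_inf tau 0 <= (t + s)%:E)%E.
  apply: le_trans Is; apply: ereal_inf_le_tmp => _ [v /= tv <-].
  by exists v => //=; exact: le_trans tv.
have [n [w [w0 un xu]]] := continuous_solution_unroll tau_delay tau_le tau_inf xsol I0.
have uK : t - K <= t + s by rewrite -lee_fin (le_trans (delay_inf_ge tau_le t0)).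
apply: (@le_trans _ _ ((C * expR g * expR (- (g / K) * t))%:E * (N (x w))%:E)%E).
  rewrite -EFinM lee_fin /history xu (le_trans (NA _ _))//.
  rewrite ler_wpM2r ?is_norm_ge0// -mulrA ler_wpM2l ?(ltW C0)//.
  rewrite rE -expRD ler_expR.
  have : t / K - 1 <= n%:R.
    by rewrite lerBlDr ler_pdivrMr//; lra.
  rewrite -subr_ge0 => /(mulr_ge0 (ltW g0)); lra.
rewrite lee_wpmul2l//.
  by rewrite lee_fin !mulr_ge0 ?expR_ge0// ltW.
by apply: ereal_sup_ubound; exists w => //; rewrite /history add0r.
Qed.
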